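(* Let $m_{\mathcal{X}}(n)$ be the number of matroids on ground set $[n]$ having no minor isomorphic to $\mathcal{W}^3$ or $M(K_4)$, and let $s(n)$ be the number of sparse paving matroids on ground set $[n]$. Then $m_{\mathcal{X}}(n)=o(s(n))$ as $n\to\infty$.
   Context: A matroid is sparse paving if every nonspanning circuit is also a hyperplane. $\mathcal{W}^3$ is the rank-3 matroid on $\{a,b,c,d,e,f\}$ whose only dependent 3-sets are $\{a,b,c\},\{c,d,e\},\{e,f,a\}$; $M(K_4)$ (the cycle matroid of $K_4$) is the rank-3 matroid on $\{a,b,c,d,e,f\}$ whose only dependent 3-sets are $\{a,b,c\},\{c,d,e\},\{e,f,a\},\{b,d,f\}$. Matroids are counted as labelled matroids on $[n]$. *)

(* Defs.v *)
From mathcomp Require Import all_boot all_order all_algebra.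
Set Implicit Arguments. Unset Strict Implicit. Unset Printing Implicit Defensive.
Import Order.TTheory GRing.Theory Num.Theory.

Section Matroid.
Variable T : finType.
Implicit Types (I : {set {set T}}) (X Y A C D : {set T}).

Definition is_matroid I : bool :=
  [&& set0 \in I,
      [forall A : {set T}, forall B : {set T}, (B \in I) && (A \subset B) ==> (A \in I)] &
      [forall A : {set T}, forall B : {set T}, (A \in I) && (B \in I) && (#|A| < #|B|) ==>
          [exists x, (x \in B :\: A) && (x |: A \in I)]]].

Definition mrank I X : nat := \max_(A in I | A \subset X) #|A|.

Definition spanning I X : bool := mrank I X == mrank I setT.
Definition circuit I X : bool :=
  (X \notin I) && [forall x in X, X :\ x \in I].
Definition hyperplane I X : bool :=
  ~~ spanning I X && [forall x in ~: X, spanning I (x |: X)].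

Definition sparse_paving I : bool :=
  [forall X : {set T}, circuit I X && ~~ spanning I X ==> hyperplane I X].

(* independent sets of the minor M / C \ D (C, D disjoint), on ground set
   the complement of C :|: D *)
Definition minor_indep I C D X : bool :=
  (X \subset ~: (C :|: D)) && (mrank I (X :|: C) == #|X| + mrank I C).

Definition has_minor (U : finType) I (N : {set {set U}}) : bool :=
  [exists C : {set T}, exists D : {set T}, [disjoint C & D] &&
    [exists f : {ffun U -> T},
       [&& injectiveb f, f @: setT == ~: (C :|: D) &
           [forall X : {set U}, (X \in N) == minor_indep I C D (f @: X)]]]].
End Matroid.

Definition a6 : 'I_6 := inord 0.
Definition b6 : 'I_6 := inord 1.
Definition c6 : 'I_6 := inord 2.
Definition d6 : 'I_6 := inord 3.
Definition e6 : 'I_6 := inord 4.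
Definition f6 : 'I_6 := inord 5.

Definition W3 : {set {set 'I_6}} :=
  [set X : {set 'I_6} | (#|X| <= 3) &&
     (X \notin [:: [set a6; b6; c6]; [set c6; d6; e6]; [set e6; f6; a6]])].

Definition MK4 : {set {set 'I_6}} :=
  [set X : {set 'I_6} | (#|X| <= 3) &&
     (X \notin [:: [set a6; b6; c6]; [set c6; d6; e6]; [set e6; f6; a6];
                   [set b6; d6; f6]])].

Definition mX (n : nat) : nat :=
  #|[set I : {set {set 'I_n}} |
      [&& is_matroid I, ~~ has_minor I W3 & ~~ has_minor I MK4]]|.

Definition sp (n : nat) : nat :=
  #|[set I : {set {set 'I_n}} | is_matroid I && sparse_paving I]|.

(* Main.v *)
Require Import Defs.
From mathcomp Require Import all_boot all_order all_algebra.
From mathcomp Require Import zify.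
Import Order.TTheory GRing.Theory Num.Theory.

(* A matroid is recovered, one size at a time, from a few "marks": for each flat
   H of rank k, after discarding loops and parallel copies, choose a basis Q of H
   and mark the circuits Q + y; given the dependent sets of size at most k, these
   determine H and hence the dependent sets of size k + 1.  If H is large, then
   exchanging pairs of elements produces many bases of H per mark.  If H is
   small, then every basis of H contained in a circuit of size k + 1 extends to
   many independent sets W outside H; but when W - a, W - c and W - e are all
   contained in such circuits W - a + d, W - c + f and W - e + b, contracting
   W - {a, c, e} yields W^3 or M(K_4).  Hence without these minors
   O(binomial(n, k) / n^2) marks suffice at a typical k, the total number of
   marks is O(2^n / n^2), and the number of matroids is 2^(O(2^n log n / n^2)).
   On the other side, all subfamilies of a Graham-Sloane code give
   2^(binomial(n, n/2) / n) sparse paving matroids, where binomial(n, n/2) has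
   order 2^n / sqrt n. *)

Set Implicit Arguments.
Unset Strict Implicit.
Unset Printing Implicit Defensive.

(** * Independent sets and closure *)

Lemma card_swap (T : finType) (Q : {set T}) y q : y \notin Q -> q \in Q -> #|y |: (Q :\ q)| = #|Q|.
Proof.
move=> yQ qQ; rewrite cardsU1 !inE (negPf yQ) andbF /= (cardsD1 q Q) qQ.
by [].
Qed.

Section MatroidTheory.
Variables (T : finType) (I : {set {set T}}).
Hypothesis matI : is_matroid I.
Implicit Types (A B Q X W E : {set T}) (a b x y z : T).

Lemma indep0 : set0 \in I.
Proof. by case/and3P: matI. Qed.

Lemma indepS A B : A \subset B -> B \in I -> A \in I.
Proof.
case/and3P: matI => _ /forallP h _ sAB BI.
by move: (h A) => /forallP/(_ B); rewrite sAB BI.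
Qed.

Lemma indep_aug1 A B : A \in I -> B \in I -> #|A| < #|B| ->
  exists2 x, x \in B :\: A & x |: A \in I.
Proof.
case/and3P: matI => _ _ /forallP h AI BI ltAB.
move: (h A) => /forallP/(_ B); rewrite AI BI ltAB /= => /existsP[x /andP[]].
by exists x.
Qed.

Lemma indep_aug A B : A \in I -> B \in I -> #|A| <= #|B| ->
  exists2 A' : {set T}, A' \in I & [/\ A \subset A', A' \subset A :|: B & #|A'| = #|B|].
Proof.
have [m] := ubnP (#|B| - #|A|); elim: m A => // m IHm A hm AI BI.
rewrite leq_eqVlt => /orP[/eqP eAB|ltAB].
  by exists A => //; rewrite subxx subsetUl.
have [x /setDP[xB xA] xAI] := indep_aug1 AI BI ltAB.
have cA : #|x |: A| = #|A|.+1 by rewrite cardsU1 xA.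
have [| |A' A'I [sA sU cA']] := IHm (x |: A) _ xAI BI.
- by rewrite cA; lia.
- by rewrite cA.
exists A' => //; split=> //; first exact: subset_trans (subsetUr _ _) sA.
apply: (subset_trans sU); rewrite subUset subsetUr subUset subsetUl !andbT.
by rewrite sub1set inE xB orbT.
Qed.

(* This is the closure of [Q] only when [Q] is independent. *)
Definition cl Q : {set T} := [set x | (x \in Q) || (x |: Q \notin I)].

Lemma sub_cl Q : Q \subset cl Q.
Proof. by apply/subsetP=> x xQ; rewrite inE xQ. Qed.

Lemma notin_cl Q x : x \notin cl Q -> (x \notin Q) /\ (x |: Q \in I).
Proof. by rewrite inE negb_or negbK => /andP. Qed.

Lemma cl_card A Q : Q \in I -> A \in I -> A \subset cl Q -> #|A| <= #|Q|.
Proof.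
move=> QI AI sA; rewrite leqNgt; apply/negP=> ltQA.
have [x /setDP[xA xQ] xI] := indep_aug1 QI AI ltQA.
by move/subsetP: sA => /(_ x xA); rewrite inE (negPf xQ) xI.
Qed.

Lemma cl_eq Q Q' : Q \in I -> Q' \in I -> Q' \subset cl Q -> #|Q'| = #|Q| ->
  cl Q' = cl Q.
Proof.
move=> QI Q'I sQ' cQ.
have sub_cl_cl A B : A \in I -> B \in I -> B \subset cl A -> #|B| = #|A| -> cl A \subset cl B.
  move=> AI BI sB cAB; apply/subsetP=> x xA; rewrite [x \in cl B]inE.
  case xB: (x \in B) => //=; apply/negP=> xBI.
  have : #|x |: B| <= #|A| by apply: cl_card; rewrite // subUset sub1set xA.
  by rewrite cardsU1 xB cAB add1n ltnn.
have sQQ' := sub_cl_cl Q Q' QI Q'I sQ' cQ.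
apply/eqP; rewrite eqEsubset sQQ' andbT; apply: sub_cl_cl => //.
exact: subset_trans (sub_cl Q) sQQ'.
Qed.

(** Otherwise [[set p']] extends inside [p' |: (p |: Q)] to an independent set of size [#|Q|.+1]. It
    omits [p], so it lies in [cl Q], against [cl_card]. *)
Lemma cl_parallel Q p p' : Q \in I -> p' \in cl Q -> [set p'] \in I ->
  [set p; p'] \notin I -> p \in cl Q.
Proof.
move=> QI p'Q p'I ppI; apply: contraT => /notin_cl[pQ pQI].
have cP : #|p |: Q| = #|Q|.+1 by rewrite cardsU1 pQ.
have [|B BI [sB sBU cB]] := indep_aug p'I pQI; first by rewrite cards1 cP.
have p'B : p' \in B by rewrite -sub1set.
have pB : p \notin B.
  apply: contra ppI => pB; apply: indepS BI.
  by rewrite subUset !sub1set pB p'B.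
have := @cl_card B Q QI BI; rewrite cB cP ltnn => -> //.
apply/subsetP => x xB; move/subsetP: sBU => /(_ x xB).
rewrite !in_setU !in_set1 => /or3P[/eqP->//|/eqP ex|xQ].
  by rewrite -ex xB in pB.
by rewrite inE xQ.
Qed.

(* [closes Q y] holds when [y |: Q] is a circuit. *)
Definition closes Q y : bool :=
  [&& y \notin Q, y |: Q \notin I & [forall q in Q, y |: (Q :\ q) \in I]].

Lemma closesP Q y : reflect
  [/\ y \notin Q, y |: Q \notin I & forall q, q \in Q -> y |: (Q :\ q) \in I]
  (closes Q y).
Proof.
apply: (iffP and3P) => -[yQ yI h]; split=> //; first by move=> q; apply/implyP/(forallP h).
by apply/forallP=> q; apply/implyP/h.
Qed.

Lemma closes_cl Q y : closes Q y -> y \in cl Q.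
Proof. by case/closesP=> _ yI _; rewrite inE yI orbT. Qed.

Lemma cl_swap Q y q : Q \in I -> closes Q y -> q \in Q -> cl (y |: (Q :\ q)) = cl Q.
Proof.
move=> QI cQy qQ; case/closesP: (cQy) => yQ _ /(_ q qQ) RI.
apply: cl_eq => //; last exact: card_swap.
rewrite subUset sub1set closes_cl //.
exact: subset_trans (subsetDl _ _) (sub_cl Q).
Qed.

(** Both facts say that [y |: Q] is a circuit, read from a different element. *)
Lemma closes_swap Q y q : Q \in I -> closes Q y -> q \in Q ->
  closes (y |: (Q :\ q)) q.
Proof.
move=> QI cQy qQ; case/closesP: (cQy) => yQ yI h.
have qy : q != y by apply: contraNneq yQ => <-.
have eU : q |: (y |: Q :\ q) = y |: Q by rewrite setUCA setD1K.
apply/closesP; split.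
- by rewrite !inE eqxx /= orbF.
- by rewrite eU.
move=> r; rewrite !inE => /orP[/eqP->|/andP[rq rQ]].
  suff -> : q |: (y |: Q :\ q) :\ y = Q by [].
  rewrite setU1K ?setD1K // !inE (negPf yQ) andbF //.
have ry : r != y by apply: contraNneq yQ => <-.
apply: indepS (h r rQ); apply/subsetP=> x; rewrite !inE.
case/orP=> [/eqP->|/andP[xr]]; first by rewrite [q == r]eq_sym rq qQ orbT.
by rewrite xr; case/orP=> [->//|/andP[_ ->]]; rewrite orbT.
Qed.

(* Swap [y] for [q]; then [z] can be swapped for an element other than [y],
   because [y] and [z] are not parallel. *)
Lemma exchange_pair Q y z q : Q \in I -> closes Q y -> z \in cl Q :\: Q ->
  [set y; z] \in I -> q \in Q ->
  exists2 Q' : {set T}, Q' \in I & [/\ #|Q'| = #|Q|, cl Q' = cl Q, y \in Q', z \in Q'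
    & q \notin Q' /\ Q' \subset Q :|: [set y; z]].
Proof.
move=> QI cQy /setDP[zH zQ] yzI qQ; case/closesP: (cQy) => yQ _ /(_ q qQ) RI.
have clR := cl_swap QI cQy qQ; have cR := card_swap yQ qQ.
have qy : q != y by apply: contraNneq yQ => <-.
have qz : q != z by apply: contraNneq zQ => <-.
have [eyz|nyz] := eqVneq y z.
  exists (y |: Q :\ q) => //; rewrite -eyz !inE !eqxx /= (negPf qy); split=> //; split=> //.
  by rewrite setUC setUSS ?subsetDl // subsetUl.
have Q1 : 1 < #|Q|.
  have -> : 2 = #|[set y; z]| by rewrite cards2 nyz.
  apply: cl_card => //; rewrite subUset !sub1set zH andbT; exact: closes_cl.
have [|B BI [sB sBU cB]] := indep_aug yzI RI; first by rewrite cR cards2 nyz.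
have [yB zB] : y \in B /\ z \in B.
  by split; apply: (subsetP sB); rewrite !inE eqxx ?orbT.
have sBC : B \subset Q :|: [set y; z].
  apply: (subset_trans sBU); apply/subsetP => x; rewrite !inE.
  by case: (x == y); case: (x == z); case: (x == q); case: (x \in Q).
exists B => //; split=> //; first by rewrite cB.
  apply: cl_eq; rewrite ?cB //; apply: (subset_trans sBC).
  rewrite subUset sub_cl subUset !sub1set zH andbT /=; exact: closes_cl.
split=> //; apply/negP=> /(subsetP sBU); rewrite !inE eqxx (negPf qy) (negPf qz).
by [].
Qed.

End MatroidTheory.

(** * Marks *)

Lemma card_double_count (S U : finType) (A : {set S}) (B : {set U}) (r : S -> U -> bool) m :
  (forall a, a \in A -> exists2 b, b \in B & r a b) ->
  (forall b, b \in B -> #|[set a in A | r a b]| <= m) -> #|A| <= m * #|B|.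
Proof.
move=> hA hB.
rewrite -sum1_card.
apply: (@leq_trans (\sum_(a in A) \sum_(b in B) r a b)).
  apply: leq_sum => a aA; have [b bB rab] := hA a aA.
  by rewrite (bigD1 b) //= rab.
rewrite exchange_big /= mulnC -sum_nat_const; apply: leq_sum => b bB.
apply: leq_trans (hB b bB); rewrite -sum1_card [leqRHS](eq_bigl (fun a => (a \in A) && r a b)).
  by rewrite -big_mkcondr /=.
by move=> a; rewrite inE.
Qed.

Section Simple.
Variables (T : finType) (I : {set {set T}}) (E : {set T}).
Hypothesis matI : is_matroid I.
Implicit Types (A B Q X W H : {set T}) (a b x y z : T).

Definition bases k : {set {set T}} := [set Q in I | (Q \subset E) && (#|Q| == k)].
Definition closers Q : {set T} := [set y in E | closes I Q y].
Definition fiber k H : {set {set T}} := [set Q in bases k | cl I Q == H].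

Hypothesis simpleE : {in E &, forall x y, [set x; y] \in I}.

Lemma basesP k Q : reflect [/\ Q \in I, Q \subset E & #|Q| = k] (Q \in bases k).
Proof. by rewrite inE; apply: (iffP and3P) => -[-> -> /eqP->]. Qed.

Lemma mem_fiber k Q Q' : Q \in bases k -> Q' \in I -> Q' \subset E -> #|Q'| = #|Q| ->
  cl I Q' = cl I Q -> Q' \in fiber k (cl I Q).
Proof.
move=> /basesP[QI sQ cQ] Q'I sQ' cQ' clQ'; rewrite inE clQ' eqxx andbT.
by apply/basesP; rewrite cQ' cQ.
Qed.

(** [exchange_pair] sends each triple [(y, z, q)] to a basis [Q'] of the same flat. At most 8
    triples share a [Q'], because [Q' :\: Q] and [Q :\: Q'] have at most two elements each. *)
Lemma closers_fiber k Q : Q \in bases k ->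
  #|closers Q| * #|E :&: cl I Q :\: Q| * k <= 8 * #|fiber k (cl I Q)|.
Proof.
move=> BQ; case/basesP: (BQ) => QI sQE cQ.
rewrite -{1}cQ -!cardsX.
pose r (t : T * T * T) (Q' : {set T}) := [&& t.1.1 \in Q' :\: Q, t.1.2 \in Q' :\: Q,
  t.2 \in Q :\: Q' & #|Q' :\: Q| <= 2].
apply: (@card_double_count _ _ _ _ r) => [[[y z] q] | Q' fQ'].
  rewrite !in_setX /= => /andP[/andP[Yy Zz] qQ].
  have [yE cQy] : y \in E /\ closes I Q y by move: Yy; rewrite inE => /andP.
  have [zE zH zQ] : [/\ z \in E, z \in cl I Q & z \notin Q].
    by move: Zz; rewrite !inE => /andP[-> /andP[-> ->]].
  have zD : z \in cl I Q :\: Q by rewrite in_setD zH zQ.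
  have [Q' Q'I [cQ' clQ' yQ' zQ' [qQ' sQ']]] :=
    exchange_pair matI QI cQy zD (simpleE yE zE) qQ.
  have yQ : y \notin Q by case/closesP: cQy.
  exists Q'.
    apply: mem_fiber => //; rewrite (subset_trans sQ') // subUset sQE.
    by rewrite subUset !sub1set yE zE.
  rewrite /r !in_setD /= yQ yQ' zQ zQ' qQ qQ' /=.
  apply: leq_trans (_ : #|[set y; z]| <= 2); last by rewrite cards2; case: eqP.
  by apply: subset_leq_card; rewrite subDset.
have cQ' : #|Q'| = #|Q|.
  by move: fQ'; rewrite !inE cQ => /andP[/andP[_ /andP[_ /eqP]]].
have eD : #|Q :\: Q'| = #|Q' :\: Q|.
  by rewrite !cardsD setIC cQ'.
case le2 : (#|Q' :\: Q| <= 2); last first.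
  rewrite [X in X <= _](_ : _ = 0) //; apply/eqP; rewrite cards_eq0; apply/eqP/setP=> t.
  by rewrite /r !inE le2 !andbF.
apply: (@leq_trans #|setX (setX (Q' :\: Q) (Q' :\: Q)) (Q :\: Q')|).
  apply: subset_leq_card; apply/subsetP=> -[[y z] q].
  by rewrite inE !in_setX => /andP[_ /and4P[-> -> -> _]].
by rewrite !cardsX eD (leq_mul (leq_mul le2 le2) le2).
Qed.

(** Single exchanges: [y |: Q :\ q] spans the same flat, has [q] as a closer, and determines [y] and
    [q]. *)
Lemma closers_active k Q : Q \in bases k ->
  #|closers Q| * k <= #|[set Q' in fiber k (cl I Q) | closers Q' != set0]|.
Proof.
move=> BQ; case/basesP: (BQ) => QI sQE cQ.
rewrite -{1}cQ -cardsX -[leqRHS]mul1n.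
pose r (t : T * T) (Q' : {set T}) := [&& t.1 \in Q' :\: Q,
  t.2 \in Q :\: Q' & #|Q' :\: Q| <= 1].
apply: (@card_double_count _ _ _ _ r) => [[y q] | Q' fQ'].
  rewrite !in_setX /= => /andP[Yy qQ].
  have [yE cQy] : y \in E /\ closes I Q y by move: Yy; rewrite inE => /andP.
  case/closesP: (cQy) => yQ _ /(_ q qQ) Q'I.
  have qy : q != y by apply: contraNneq yQ => <-.
  exists (y |: Q :\ q).
    rewrite inE; apply/andP; split.
      apply: mem_fiber => //; last exact: cl_swap.
        by rewrite subUset sub1set yE (subset_trans (subsetDl _ _)).
      exact: card_swap.
    apply/set0Pn; exists q; rewrite inE (subsetP sQE) //=.
    exact: closes_swap.
  apply/and3P; split; first by rewrite !inE eqxx yQ.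
    by rewrite !inE qQ eqxx (negPf qy).
  apply: leq_trans (_ : #|[set y]| <= 1); last by rewrite cards1.
  apply: subset_leq_card; apply/subsetP=> x; rewrite !inE.
  by case: (x == y); case: (x \in Q); rewrite ?andbF.
have cQ' : #|Q'| = #|Q|.
  by move: fQ'; rewrite !inE cQ => /andP[/andP[/andP[_ /andP[_ /eqP]]]].
have eD : #|Q :\: Q'| = #|Q' :\: Q|.
  by rewrite !cardsD setIC cQ'.
case le2 : (#|Q' :\: Q| <= 1); last first.
  rewrite [X in X <= _](_ : _ = 0) //; apply/eqP; rewrite cards_eq0; apply/eqP/setP=> t.
  by rewrite /r !inE le2 !andbF.
apply: (@leq_trans #|setX (Q' :\: Q) (Q :\: Q')|).
  apply: subset_leq_card; apply/subsetP=> -[y q].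
  by rewrite inE !in_setX => /andP[_ /and3P[-> -> _]].
by rewrite !cardsX eD (leq_mul le2 le2).
Qed.

Definition active k : {set {set T}} := [set Q in bases k | closers Q != set0].

Lemma card_bases k : #|bases k| <= 'C(#|E|, k).
Proof.
rewrite -cards_draws; apply: subset_leq_card; apply/subsetP=> Q.
by case/basesP=> _ sQ cQ; rewrite inE sQ cQ eqxx.
Qed.

(* With [W - e + b], [W - a + d] and [W - c + f] three circuits, contracting
   [W - a - c - e] leaves the three sides [abc], [cde], [efa] of a triangle. *)
Definition triangle_free :=
  forall W, W \in I -> W \subset E -> #|[set a in W | closers (W :\ a) != set0]| <= 2.

(** Pairs of an active [Q] and a [y] off its flat are counted through the independent set
    [W = y |: Q], in which at most two elements can serve as [y]. *)
Lemma active_outside k : triangle_free ->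
  \sum_(Q in active k) #|E :\: cl I Q| <= 2 * 'C(#|E|, k.+1).
Proof.
move=> tf.
have -> : \sum_(Q in active k) #|E :\: cl I Q| =
    \sum_y #|[set Q in active k | y \in E :\: cl I Q]|.
  under eq_bigr => Q _ do rewrite -sum1_card.
  rewrite (exchange_big_dep predT) //=; apply: eq_bigr => y _.
  by rewrite -sum1_card; apply: eq_bigl => Q; rewrite inE.
apply: (@leq_trans (\sum_y
   #|[set W in bases k.+1 | (y \in W) && (closers (W :\ y) != set0)]|)).
  apply: leq_sum => y _; rewrite -(card_in_imset (f := fun Q => y |: Q)); last first.
    move=> Q Q'; rewrite !inE => /andP[_ /andP[/norP[yQ _] _]].
    case/andP=> _ /andP[/norP[yQ' _] _] e.
    by rewrite -(setU1K yQ) e setU1K.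
  apply: subset_leq_card; apply/subsetP=> W /imsetP[Q]; rewrite inE => /andP[].
  rewrite inE => /andP[/basesP[QI sQ cQ] aQ] /setDP[yE /notin_cl[yQ yI]] ->.
  rewrite inE setU1K // aQ setU11 !andbT; apply/basesP; split=> //.
    by rewrite subUset sub1set yE.
  by rewrite cardsU1 yQ cQ.
have -> : \sum_y #|[set W in bases k.+1 | (y \in W) && (closers (W :\ y) != set0)]| =
    \sum_(W in bases k.+1) #|[set a in W | closers (W :\ a) != set0]|.
  under eq_bigr => y _ do rewrite -sum1_card.
  rewrite (exchange_big_dep (mem (bases k.+1))) /=; last by move=> y W _; rewrite inE => /andP[].
  apply: eq_bigr => W BW; rewrite -sum1_card; apply: eq_bigl => y.
  by rewrite !inE; rewrite inE in BW; rewrite BW.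
apply: (@leq_trans (\sum_(W in bases k.+1) 2)).
  by apply: leq_sum => W /basesP[WI sW _]; apply: tf.
by rewrite sum_nat_const mulnC leq_mul2l card_bases.
Qed.

Definition flat_basis k H : {set T} := odflt set0 [pick Q in fiber k H].

Lemma flat_basis_fiber k H : H \in (fun Q => cl I Q) @: bases k -> flat_basis k H \in fiber k H.
Proof.
case/imsetP=> Q BQ ->; rewrite /flat_basis; case: pickP => [//|/(_ Q)].
by rewrite inE BQ eqxx.
Qed.

Definition marks k : {set {set T}} :=
  \bigcup_(H in (fun Q => cl I Q) @: bases k)
     [set y |: flat_basis k H | y in closers (flat_basis k H)].

(* A flat containing more than half of the elements outside its basis has many
   bases by [closers_fiber]; the bases of the others extend outside the flat in
   many ways, so that [active_outside] bounds their number. *)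
Lemma card_marks k : triangle_free ->
  #|marks k| * k * (#|E| - k) <= 4 * 'C(#|E|, k.+1) + 16 * 'C(#|E|, k).
Proof.
move=> tf.
pose Hs := (fun Q => cl I Q) @: bases k.
have le1 : #|marks k| <= \sum_(H in Hs) #|closers (flat_basis k H)|.
  rewrite /marks -/Hs; elim/big_rec2: _ => [|H m S _ IH]; first by rewrite cards0.
  apply: leq_trans (leq_card_setU _ _) _; exact: leq_add (leq_imset_card _ _) IH.
have le2 H : H \in Hs -> #|closers (flat_basis k H)| * k * (#|E| - k) <=
    16 * #|fiber k H| + 2 * \sum_(Q in active k | cl I Q == H) #|E :\: cl I Q|.
  move=> HHs; have := flat_basis_fiber HHs; set Q := flat_basis k H.
  rewrite inE => /andP[BQ /eqP clQ]; have hA := closers_fiber BQ.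
  have hB := closers_active BQ; rewrite clQ in hA hB.
  case/basesP: (BQ) => QI sQ cQ.
  have sQH : Q \subset H by rewrite -clQ sub_cl.
  have cE : #|E| - k = #|E :&: H :\: Q| + #|E :\: H|.
    have sQEH : Q \subset E :&: H by rewrite subsetI sQ.
    have := cardsID H E; have := subset_leq_card sQEH.
    rewrite (cardsD (E :&: H)) (setIidPr sQEH); lia.
  (* One of the two parts of [E :\: Q] makes up at least half of it; the doubling turns the 8 of
     [closers_fiber] into 16 and the 1 of [closers_active] into 2. *)
  case: (leqP (#|E| - k) (2 * #|E :&: H :\: Q|)) => [big|small].
    by nia.
  have le3 : #|E| - k <= 2 * #|E :\: H| by lia.
  have -> : \sum_(Q0 in active k | cl I Q0 == H) #|E :\: cl I Q0| =
     #|[set Q' in fiber k H | closers Q' != set0]| * #|E :\: H|.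
    rewrite -sum_nat_const; apply: congr_big => //.
      by move=> Q'; rewrite !inE; rewrite andbAC.
    by move=> Q' /andP[_ /eqP->].
  by nia.
apply: (@leq_trans (\sum_(H in Hs) #|closers (flat_basis k H)| * k * (#|E| - k))).
  by rewrite -!big_distrl /= !leq_mul.
apply: leq_trans (leq_sum _ le2) _; rewrite big_split /= -!big_distrr /=.
have -> : \sum_(H in Hs) #|fiber k H| = #|bases k|.
  rewrite -[RHS]sum1_card [RHS](partition_big_imset (fun Q => cl I Q)) /=.
  apply: eq_bigr => H _; rewrite -sum1_card; apply: eq_bigl => Q.
  by rewrite inE.
have -> : \sum_(H in Hs) \sum_(Q in active k | cl I Q == H) #|E :\: cl I Q| =
    \sum_(Q in active k) #|E :\: cl I Q|.
  symmetry; apply: (partition_big (fun Q => cl I Q) (mem Hs)) => Q.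
  by rewrite inE => /andP[BQ _]; apply/imsetP; exists Q.
have := active_outside k tf; have := card_bases k; lia.
Qed.

End Simple.

(** * Recovering a matroid from its code *)

Section Code.
Variable T : finType.
Implicit Types (I : {set {set T}}) (E Q X : {set T}).

(** Since [x = y] is allowed, loops are excluded along with parallel pairs. *)
Definition simple I E : bool := [forall x in E, forall y in E, [set x; y] \in I].

Definition simple_part I : {set T} := [arg max_(E > set0 | simple I E) #|E|].

Lemma simple0 I : simple I set0.
Proof. by apply/forallP=> x; rewrite inE. Qed.

Lemma simple_part_simple I : {in simple_part I &, forall x y, [set x; y] \in I}.
Proof.
rewrite /simple_part; case: arg_maxnP => [|E sE _]; first exact: simple0.
by move=> x y xE yE; move/forallP/(_ x)/implyP/(_ xE)/forallP/(_ y)/implyP/(_ yE): sE.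
Qed.

(** An outside [x] independent of every member could be added, against maximality. *)
Lemma simple_part_parallel I x : [set x] \in I ->
  exists2 x', x' \in simple_part I & (x' = x) \/ [set x; x'] \notin I.
Proof.
move=> xI; have simE := @simple_part_simple I.
case xE: (x \in simple_part I); first by exists x => //; left.
have [/existsP[x' /andP[x'E h]]|/existsPn h] :=
  boolP [exists x' in simple_part I, [set x; x'] \notin I].
  by exists x' => //; right.
have hx y : y \in simple_part I -> [set x; y] \in I.
  by move=> yE; have := h y; rewrite yE /= negbK.
have : simple I (x |: simple_part I).
  apply/forallP=> y; apply/implyP=> yU; apply/forallP=> z; apply/implyP.
  case/setU1P: yU => [->|yE] /setU1P[->|zE].
  - by rewrite setUid.
  - exact: hx.
  - by rewrite setUC hx.
  - exact: simE.
suff maxE E : simple I E -> #|E| <= #|simple_part I|.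
  by move/maxE; rewrite cardsU1 xE ltnn.
rewrite /simple_part; case: arg_maxnP => [|E' _ maxE]; first exact: simple0.
exact: maxE.
Qed.

(* The dependent sets of size at most 2 determine the loops and parallel
   classes, so that larger dependent sets need only be marked inside the simple
   restriction. *)
Definition code I : {set {set T}} := [set X | (X \notin I) && (#|X| <= 2)] :|:
  \bigcup_(k < #|T| | 2 <= k) marks I (simple_part I) k.

Lemma code_dep I X : X \in code I -> X \notin I.
Proof.
case/setUP => [|/bigcupP[k _ /bigcupP[H HH /imsetP[y]]]]; first by rewrite inE => /andP[].
by rewrite inE => /andP[_ /closesP[_ yI _] ->].
Qed.

Lemma code_le2 I X : #|X| <= 2 -> (X \in I) = (X \notin code I).
Proof.
move=> X2; case XI: (X \in I); apply/esym.
  by apply: contraL XI => /code_dep.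
by apply/negbTE; rewrite negbK in_setU inE XI X2.
Qed.

(** A circuit [X] of [I1] lies in a flat of rank [k]. The shared marks of that flat place [X] in the
    [I2]-closure of one basis [R] with [k] elements, so [X] is too large to be independent in
    [I2]. *)
Lemma code_dep_succ (I1 I2 : {set {set T}}) : is_matroid I1 -> is_matroid I2 -> code I1 = code I2 ->
  forall k, 2 <= k -> (forall X, #|X| <= k -> (X \in I1) = (X \in I2)) ->
  forall X, #|X| = k.+1 -> X \notin I1 -> X \notin I2.
Proof.
move=> mI1 mI2 ec k k2 IH X cX XI1.
have [/existsP[x /andP[xX xI1]]|/existsPn circX] := boolP [exists x in X, X :\ x \notin I1].
  have cXx : #|X :\ x| <= k by move: cX; rewrite (cardsD1 x) xX add1n => -[->].
  by apply: contra xI1 => XI2; rewrite (IH _ cXx); exact: (indepS mI2 (subD1set _ _) XI2).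
apply/negP=> XI2.
have [x0 x0X] : exists x, x \in X by apply/set0Pn; rewrite -card_gt0 cX.
set P := X :\ x0.
have PI : P \in I1 by have := circX x0; rewrite x0X negbK.
have cP : #|P| = k by move: cX; rewrite (cardsD1 x0) x0X add1n => -[].
have eX : x0 |: P = X by rewrite setD1K.
have sXH : X \subset cl I1 P.
  by rewrite -eX subUset sub_cl sub1set inE eX XI1 orbT.
clearbody P.
have kT : k < #|T| by rewrite -cX max_card.
have markP Y : Y \in marks I1 (simple_part I1) k -> Y \notin I2.
  move=> Yk; apply: code_dep; rewrite -ec in_setU; apply/orP; right.
  by apply/bigcupP; exists (Ordinal kT).
have simE := @simple_part_simple I1; have parE := @simple_part_parallel I1.
move: (simple_part I1) markP simE parE => E markP simE parE.
have rep x : [set x] \in I1 -> x \in cl I1 P -> exists2 x', x' \in E :&: cl I1 P &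
     [/\ [set x'] \in I1, (x' = x) \/ [set x; x'] \notin I1 & (x' = x) \/ [set x'; x] \notin I1].
  move=> xI xP; have [x' x'E h] := parE x xI.
  have x'I : [set x'] \in I1 by rewrite -[[set x']]setUid simE.
  have h' : (x' = x) \/ [set x'; x] \notin I1 by rewrite setUC.
  exists x'; last by split.
  rewrite in_setI x'E /=.
  by case: h => [->//|h]; apply: (cl_parallel mI1 PI xP xI); rewrite setUC.
(* A maximal independent subset of [E] inside the flat spans it. *)
have [Q BQ clQ] : exists2 Q, Q \in bases I1 E k & cl I1 Q = cl I1 P.
  pose p (Q : {set T}) := (Q \in I1) && (Q \subset E :&: cl I1 P).
  have p0 : p set0 by rewrite /p (indep0 mI1) sub0set.
  case: (arg_maxnP (fun Q : {set T} => #|Q|) p0) => Q /andP[QI]; rewrite subsetI.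
  case/andP=> sQE sQP maxQ.
  have le1 := cl_card mI1 PI QI sQP.
  suff cQ : #|Q| = #|P|.
    exists Q; last exact: (cl_eq mI1 PI QI sQP cQ).
    by apply/basesP; split; [exact: QI | exact: sQE | rewrite cQ].
  apply/eqP; rewrite eqn_leq le1 /= leqNgt; apply/negP=> ltQP.
  have [q /setDP[qP qQ] qI] := indep_aug1 mI1 QI PI ltQP.
  have q1I : [set q] \in I1 by apply: (indepS mI1 _ qI); apply: subsetUl.
  have [q' q'E [q'I h _]] := rep q q1I (subsetP (sub_cl I1 P) _ qP).
  have qcl : q \notin cl I1 Q by rewrite inE (negPf qQ) qI.
  have /notin_cl[q'Q q'QI] : q' \notin cl I1 Q.
    by apply: contra qcl => q'cl; case: h => [<-//|h]; apply: (cl_parallel mI1 QI q'cl q'I h).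
  have := maxQ (q' |: Q); rewrite /p q'QI subUset sub1set q'E subsetI sQE sQP => /(_ isT).
  by rewrite /= cardsU1 q'Q /= add1n ltnn.
have HH : cl I1 P \in (fun Q => cl I1 Q) @: bases I1 E k by apply/imsetP; exists Q.
have [R fR markR] : exists2 R, R \in fiber I1 E k (cl I1 P) &
    forall y, y \in closers I1 E R -> y |: R \notin I2.
  exists (flat_basis I1 E k (cl I1 P)); first exact: flat_basis_fiber HH.
  move=> y Yy; apply: markP; apply/bigcupP; exists (cl I1 P); first exact: HH.
  by apply/imsetP; exists y.
move: fR; rewrite inE => /andP[/basesP[RI sRE cR] /eqP clR].
have RI2 : R \in I2 by rewrite -IH ?cR.
(* An [x] off [R] either closes [R] and gives a mark, or [x |: R] has a dependent subset of size
   [k], which [IH] transfers to [I2]. *)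
have dep2 x : x \in E -> x \in cl I1 P -> x \in cl I2 R.
  move=> xE; rewrite -clR !inE; case xR: (x \in R); first by [].
  rewrite /= => xRI.
  case cRx: (closes I1 R x).
    by apply: markR; rewrite inE xE.
  have : ~~ [forall q in R, x |: (R :\ q) \in I1].
    by apply: contraFN cRx => h; rewrite /closes xR xRI.
  case/forallPn => q; rewrite negb_imply => /andP[qR].
  have cS := card_swap (negbT xR) qR.
  rewrite IH; last by rewrite cS cR.
  apply: contra => xI2; exact: (indepS mI2 (setUS _ (subD1set R q)) xI2).
have IH2 (Y : {set T}) : #|Y| <= 2 -> (Y \in I1) = (Y \in I2) by move=> Y2; apply: IH; apply: leq_trans k2.
(* Each element of [X] is a loop, lies in [E], or is parallel to a member of [E]; loops and parallel
   pairs agree in [I1] and [I2] by [IH2]. *)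
have sX2 : X \subset cl I2 R.
  apply/subsetP=> x xX; have xH := subsetP sXH x xX.
  have eI : ([set x] \in I1) = ([set x] \in I2) by rewrite IH2 ?cards1.
  case xI : ([set x] \in I1); last first.
    rewrite inE; apply/orP; right; apply: contraFN xI => xI2.
    by rewrite eI; exact: (indepS mI2 (subsetUl _ R) xI2).
  have [x' /setIP[x'E x'H] [x'I h _]] := rep x xI xH.
  have x'2 := dep2 x' x'E x'H; case: h => [<-|h]; first exact: x'2.
  have x'I2 : [set x'] \in I2 by rewrite -IH2 ?cards1.
  apply: (cl_parallel mI2 RI2 x'2 x'I2).
  by rewrite -IH2; [exact: h | rewrite cards2; case: eqP].
by have := cl_card mI2 RI2 XI2 sX2; rewrite cX cR ltnn.
Qed.

Lemma code_inj (I1 I2 : {set {set T}}) : is_matroid I1 -> is_matroid I2 -> code I1 = code I2 -> I1 = I2.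
Proof.
move=> mI1 mI2 ec.
suff h m : forall X : {set T}, #|X| <= m.+2 -> (X \in I1) = (X \in I2).
  by apply/setP=> X; exact: (h #|X| X (leqW (leqW (leqnn _)))).
elim: m => [|m IHm] X; first by move=> X2; rewrite (code_le2 I1 X2) (code_le2 I2 X2) ec.
rewrite leq_eqVlt => /orP[/eqP cX|]; last exact: IHm.
have m2 : 2 <= m.+2 by [].
apply/idP/idP; apply: contraLR.
  exact: (code_dep_succ mI2 mI1 (esym ec) m2 (fun Y hY => esym (IHm Y hY)) cX).
exact: (code_dep_succ mI1 mI2 ec m2 IHm cX).
Qed.

End Code.

(** * Size of the code *)

(** The shift [j] is general because Pascal's rule reduces [j.+1] to [j.+1] and [j]; for [j = 0] the
    first term is split off. *)
Lemma sum_bin_le M N j : \sum_(i < N) 'C(M, i + j) <= 2 ^ M.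
Proof.
elim: M N j => [|M IH] N j.
  under eq_bigr => i _ do rewrite bin0n addn_eq0.
  case: N => [|N]; first by rewrite big_ord0.
  by rewrite big_ord_recl big1 // addn0 /=; case: eqP.
rewrite expnS mul2n -addnn; case: j => [|j]; last first.
  under eq_bigr => i _ do rewrite addnS binS -addnS.
  rewrite big_split /=; exact: (leq_add (IH N j.+1) (IH N j)).
case: N => [|N]; first by rewrite big_ord0.
have hA : 1 + \sum_(i < N) 'C(M, i.+1) <= 2 ^ M.
  have := IH N.+1 0; rewrite big_ord_recl bin0; congr (1 + _ <= _).
  by apply: eq_bigr => i _; rewrite addn0.
have hB : \sum_(i < N) 'C(M, i) <= 2 ^ M.
  by have := IH N 0; congr (_ <= _); apply: eq_bigr => i _; rewrite addn0.
rewrite big_ord_recl bin0 (eq_bigr (fun i : 'I_N => 'C(M, i.+1) + 'C(M, i))); last first.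
  by move=> i _; rewrite addn0 -binS.
rewrite big_split /= addnA; exact: leq_add.
Qed.

(** Two absorption identities trade the factor [n.+1 * n.+2] for a shift of the binomial
    coefficient, so that the saving of order n^2 survives summation over [k]. *)
Lemma bin_mul2 n k : k <= n ->
  n.+1 * n.+2 * 'C(n, k) = k.+1 * (n.+1 - k) * 'C(n.+2, k.+1).
Proof.
move=> kn; have h1 := mul_bin_diag n.+2 k; have h2 := mul_bin_down n.+1 k.
rewrite /= in h1 h2; nia.
Qed.

(** Up to a factor 2, the quotient 2^n / ((n+1)(n+2)) is nondecreasing; this carries a bound from
    the simple part to the whole ground set. *)
Lemma expn2_quad m n : m <= n -> 2 ^ m * (n.+1 * n.+2) <= 2 * 2 ^ n * (m.+1 * m.+2).
Proof.
elim: n => [|n IH]; first by rewrite leqn0 => /eqP->.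
rewrite leq_eqVlt ltnS => /orP[/eqP->|mn]; first by rewrite -mulnA leq_pmull.
case: n IH mn => [|n] IH mn; first by move: mn; rewrite leqn0 => /eqP->.
have := IH mn; rewrite (expnS 2 n.+1); nia.
Qed.

Section CodeSize.
Variables (T : finType) (I : {set {set T}}).
Hypothesis matI : is_matroid I.
Hypothesis tf : triangle_free I (simple_part I).

Lemma card_marks_bin k : 2 <= k ->
  #|marks I (simple_part I) k| * (#|simple_part I|.+1 * #|simple_part I|.+2) <=
  64 * 'C(#|simple_part I|.+2, k.+1) + 8 * 'C(#|simple_part I|.+2, k.+2).
Proof.
move=> k2; have simE := @simple_part_simple T I.
move: (simple_part I) simE tf => E simE tfE.
(* A mark is a subset of [E] with [k.+1] elements, so its existence gives [k < #|E|] and lets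
   [k * (#|E| - k)] be cancelled. *)
have [->|/set0Pn[X /bigcupP[H HH /imsetP[y]]]] := eqVneq (marks I E k) set0.
  by rewrite cards0.
have := flat_basis_fiber HH; rewrite inE => /andP[/basesP[_ sQ cQ] _].
rewrite inE => /andP[yE /closesP[yQ _ _]] _.
have kE : k < #|E|.
  have : #|y |: flat_basis I E k H| <= #|E| by rewrite subset_leq_card // subUset sub1set yE.
  by rewrite cardsU1 yQ cQ.
have h := card_marks matI simE k tfE.
have h1 := bin_mul2 (ltnW kE); have h2 := bin_mul2 kE.
move: h h1 h2; set m := #|marks _ _ _|; move: {tfE simE sQ yE HH cQ} #|E| kE => n kn.
set c := 'C(n, k); set c1 := 'C(n, k.+1); set d1 := 'C(n.+2, k.+1); set d2 := 'C(n.+2, k.+2).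
move=> h h1 h2.
have [j ej] : exists j, n = k + j.+1 by exists (n - k.+1); lia.
rewrite ej in h h1 h2 *.
have e1 : k + j.+1 - k = j.+1 by lia.
have e2 : (k + j.+1).+1 - k = j.+2 by lia.
have e3 : (k + j.+1).+1 - k.+1 = j.+1 by lia.
rewrite e1 in h; rewrite e2 in h1; rewrite e3 in h2.
set N := (k + j.+1).+1 * (k + j.+1).+2 in h1 h2 *.
have h3 : m * N * (k * j.+1) <= 4 * (k.+2 * j.+1 * d2) + 16 * (k.+1 * j.+2 * d1).
  by rewrite -h1 -h2; move: h; clear; move: N => N; nia.
(* From [k >= 2] follows [k.+2 <= 2 * k]; with [j.+2 <= 2 * j.+1] the constants 4 and 16 become 8
   and 64. *)
have h4 : k.+2 * j.+1 * d2 <= 2 * (k * j.+1) * d2 by rewrite leq_mul2r; apply/orP; right; nia.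
have h5 : k.+1 * j.+2 * d1 <= 4 * (k * j.+1) * d1 by rewrite leq_mul2r; apply/orP; right; nia.
have kj : 0 < k * j.+1 by rewrite muln_gt0 /= andbT; lia.
rewrite -(leq_pmul2r kj); apply: leq_trans h3 _.
by move: h4 h5; clear; move: (k * j.+1) (k.+2 * j.+1) (k.+1 * j.+2) => x y z; nia.
Qed.

(** The two binomial sums are at most [4 * 2 ^ #|E|] each, which gives 4 (64 + 8) = 288, doubled by
    [expn2_quad]. The last term bounds the sets of size at most 2. *)
Lemma card_code :
  #|code I| * (#|T|.+1 * #|T|.+2) <= 576 * 2 ^ #|T| + #|T|.+1 ^ 2 * (#|T|.+1 * #|T|.+2).
Proof.
set E := simple_part I; set K := #|E|.+1 * #|E|.+2.
pose small := [set X | (X \notin I) && (#|X| <= 2)].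
pose big := \bigcup_(k < #|T| | 2 <= k) marks I E k.
have le_small : #|small| <= #|T|.+1 ^ 2.
  have -> : #|T|.+1 = #|{: option T}| by rewrite card_option.
  rewrite -mulnn -card_prod -cardsT.
  (* Sets of size at most 2 are coded by two optional elements. *)
  pose f (ab : option T * option T) : {set T} := [set x | (Some x == ab.1) || (Some x == ab.2)].
  apply: leq_trans (leq_imset_card f _); apply: subset_leq_card; apply/subsetP=> X.
  rewrite inE => /andP[_ X2]; apply/imsetP.
  case: (leqP #|X| 1) => [X1|X1].
    have [->|[x xX]] := set_0Vmem X.
      by exists (None, None) => //; apply/setP=> x; rewrite !inE.
    exists (Some x, None) => //; apply/setP=> z; rewrite !inE orbF.
    by apply/idP/eqP => [zX|[->//]]; move/card_le1_eqP: X1 => /(_ z x zX xX) ->.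
  have /cards2P[x [y [_ ->]]] : #|X| == 2 by rewrite eqn_leq X2 X1.
  by exists (Some x, Some y) => //; apply/setP=> z; rewrite !inE.
have le_big : #|big| * K <= 288 * 2 ^ #|E|.
  have le1 : #|big| <= \sum_(k < #|T| | 2 <= k) #|marks I E k|.
    rewrite /big; elim/big_rec2: _ => [|k m S _ IH]; first by rewrite cards0.
    apply: leq_trans (leq_card_setU _ _) _; exact: leq_add (leqnn _) IH.
  have le2 : \sum_(k < #|T| | 2 <= k) #|marks I E k| * K <=
     \sum_(k < #|T|) (64 * 'C(#|E|.+2, k + 1) + 8 * 'C(#|E|.+2, k + 2)).
    rewrite big_mkcond; apply: leq_sum => k _; case: ifP => // k2.
    by rewrite addn1 addn2; apply: card_marks_bin.
  rewrite big_split /= -!big_distrr -big_distrl /= in le2.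
  have := sum_bin_le #|E|.+2 #|T| 1; have := sum_bin_le #|E|.+2 #|T| 2.
  rewrite !expnS.
  move: le1 le2; set a := \sum_(k < _ | _) _; set b := \sum_(k < _) _; set c := \sum_(k < _) _.
  clearbody K; move: #|big| (2 ^ #|E|) => x y; nia.
have le_code : #|code I| <= #|small| + #|big| by rewrite /code leq_card_setU.
have := @expn2_quad _ _ (max_card (mem E)); rewrite -/K => hK.
have K0 : 0 < K by [].
have le3 : #|big| * (#|T|.+1 * #|T|.+2) <= 576 * 2 ^ #|T|.
  rewrite -(leq_pmul2r K0); move: le_big hK; clear.
  by move: #|big| (2 ^ #|E|) (2 ^ #|T|) (#|T|.+1 * _) K => x y z t u; nia.
apply: leq_trans (leq_mul le_code (leqnn _)) _; rewrite mulnDl addnC.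
exact: leq_add le3 (leq_mul le_small (leqnn _)).
Qed.

End CodeSize.

(** * The triangle minor *)

Section Minor.
Variables (T : finType) (I : {set {set T}}).
Hypothesis matI : is_matroid I.
Implicit Types (C D X W Z : {set T}).

Lemma mrank_le X : mrank I X <= #|X|.
Proof. by apply/bigmax_leqP => A /andP[_ /subset_leq_card]. Qed.

Lemma mrank_card X : (mrank I X == #|X|) = (X \in I).
Proof.
apply/eqP/idP => [e|XI].
  have h0 : (set0 \in I) && (set0 \subset X) by rewrite (indep0 matI) sub0set.
  have [|A /andP[AI sA] eA] := @eq_bigmax_cond _ [pred A : {set T} | (A \in I) && (A \subset X)] (fun A => #|A|).
    by apply/card_gt0P; exists set0.
  suff <- : A = X by [].
  by apply/eqP; rewrite eqEcard sA -e /mrank eA leqnn.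
apply/eqP; rewrite eqn_leq mrank_le /=.
by apply: (@leq_bigmax_cond _ (fun A : {set T} => (A \in I) && (A \subset X)) (fun A => #|A|) X); rewrite XI /=.
Qed.

Lemma minor_indepE C D X : C \in I -> [disjoint X & C] ->
  minor_indep I C D X = (X \subset ~: (C :|: D)) && (X :|: C \in I).
Proof.
move=> CI dXC; rewrite /minor_indep; congr andb.
have /eqP -> : mrank I C == #|C| by rewrite mrank_card.
by rewrite -mrank_card cardsU disjoint_setI0 // cards0 subn0.
Qed.

(** If [d] lay in that flat, [d |: (W :\ a :\ e)] would span it, and the circuit [d |: (W :\ a)]
    would put [e] in it, against [W \in I]. *)
Lemma notin_cl_side W a e d : W \in I -> a \in W -> e \in W -> a != e ->
  closes I (W :\ a) d -> d \notin cl I (W :\ e).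
Proof.
move=> WI aW eW ae cd; apply/negP=> dcl.
have eWa : e \in W :\ a by rewrite !inE eq_sym ae.
have QI : W :\ e \in I := indepS matI (subD1set _ _) WI.
have WaI : W :\ a \in I := indepS matI (subD1set _ _) WI.
case/closesP: (cd) => dWa _ /(_ e eWa) RI.
have /closesP[_ eR _] := closes_swap matI WaI cd eWa.
have cR : #|d |: (W :\ a :\ e)| = #|W :\ e|.
  rewrite (card_swap dWa eWa); have := cardsD1 a W; have := cardsD1 e W.
  by rewrite aW eW => -> /eqP; rewrite eqn_add2l => /eqP.
have sR : d |: (W :\ a :\ e) \subset cl I (W :\ e).
  rewrite subUset sub1set dcl; apply: subset_trans (sub_cl I _).
  by rewrite setSD // subD1set.
have eclR := cl_eq matI QI RI sR cR.
have : e \in cl I (W :\ e) by rewrite -eclR inE eR orbT.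
by rewrite inE setD11 /= setD1K // WI.
Qed.

Lemma line_indep W e b w : W \in I -> closes I (W :\ e) b -> w \notin cl I (W :\ e) ->
  w |: (W :\ e) \in I /\ forall q, q \in W :\ e -> w |: (b |: (W :\ e :\ q)) \in I.
Proof.
move=> WI cb wcl; have QI : W :\ e \in I := indepS matI (subD1set _ _) WI.
split=> [|q qQ]; first by case/notin_cl: wcl.
by move: wcl; rewrite -(cl_swap matI QI cb qQ) => /notin_cl[].
Qed.

End Minor.

(** * Coordinates for subsets of the six-element ground set *)

Lemma ord6P (P : 'I_6 -> Prop) :
  P a6 -> P b6 -> P c6 -> P d6 -> P e6 -> P f6 -> forall i, P i.
Proof.
move=> pa pb pc pd pe pf [i i6].
have e (j : 'I_6) : nat_of_ord j = i -> P j -> P (Ordinal i6).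
  by move=> eji; have -> : Ordinal i6 = j by apply: val_inj.
have [ei|[ei|[ei|[ei|[ei|ei]]]]] : i = 0 \/ i = 1 \/ i = 2 \/ i = 3 \/ i = 4 \/ i = 5 by lia.
- by apply: e pa; rewrite inordK ?ei.
- by apply: e pb; rewrite inordK ?ei.
- by apply: e pc; rewrite inordK ?ei.
- by apply: e pd; rewrite inordK ?ei.
- by apply: e pe; rewrite inordK ?ei.
- by apply: e pf; rewrite inordK ?ei.
Qed.

Lemma enum_ord6 : enum 'I_6 = [:: a6; b6; c6; d6; e6; f6].
Proof. by apply: (inj_map val_inj); rewrite val_enum_ord /= !inordK. Qed.

Lemma card_set6 (X : {set 'I_6}) : #|X| =
  (a6 \in X) + (b6 \in X) + (c6 \in X) + (d6 \in X) + (e6 \in X) + (f6 \in X).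
Proof.
rewrite -sum1_card big_mkcond -big_enum enum_ord6 !big_cons big_nil /=.
by do 6!case: (_ \in X).
Qed.

Lemma eq_set6 (X Y : {set 'I_6}) : (X == Y) =
  [&& (a6 \in X) == (a6 \in Y), (b6 \in X) == (b6 \in Y), (c6 \in X) == (c6 \in Y),
      (d6 \in X) == (d6 \in Y), (e6 \in X) == (e6 \in Y) & (f6 \in X) == (f6 \in Y)].
Proof.
apply/eqP/idP => [->|]; first by rewrite !eqxx.
by case/and5P=> /eqP ? /eqP ? /eqP ? /eqP ? /andP[/eqP ? /eqP ?]; apply/setP; apply: ord6P.
Qed.

(** Membership becomes a Boolean function of six bits, so that [triangle_minor] ends in a finite
    case check. *)
Lemma in_lines6 (X : {set 'I_6}) :
  let xa := a6 \in X in let xb := b6 \in X in let xc := c6 \in X in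
  let xd := d6 \in X in let xe := e6 \in X in let xf := f6 \in X in
  ((X \in W3) = [&& xa + xb + xc + xd + xe + xf <= 3,
     ~~ [&& xa, xb, xc, ~~ xd, ~~ xe & ~~ xf],
     ~~ [&& ~~ xa, ~~ xb, xc, xd, xe & ~~ xf] &
     ~~ [&& xa, ~~ xb, ~~ xc, ~~ xd, xe & xf]]) *
  ((X \in MK4) = [&& X \in W3 & ~~ [&& ~~ xa, xb, ~~ xc, xd, ~~ xe & xf]]).
Proof.
have h (i j : 'I_6) : (i == j) = (nat_of_ord i == nat_of_ord j) by [].
rewrite /= ![_ \in W3]inE ![_ \in MK4]inE !inE card_set6 !eq_set6 !inE !h !inordK //=.
by do 6!case: (_ \in X).
Qed.

(** * The six points of a triangle in a contraction *)

Section Triangle.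
Variables (T : finType) (I : {set {set T}}) (W : {set T}) (a b c d e f : T).
Hypothesis matI : is_matroid I.
Hypotheses (WI : W \in I) (aW : a \in W) (cW : c \in W) (eW : e \in W).
Hypotheses (ac : a != c) (ce : c != e) (ea : e != a).
Hypotheses (cb : closes I (W :\ e) b) (cd : closes I (W :\ a) d) (cf : closes I (W :\ c) f).

Implicit Types (X : {set 'I_6}) (Z : {set T}) (w x y z : T).
(** Contracting [C] leaves the corners [a], [c], [e] of a triangle, with [b] on the side [ac], [d]
    on [ce] and [f] on [ea]. *)
Let C := W :\ a :\ c :\ e.
Let pt : {ffun 'I_6 -> T} := [ffun i : 'I_6 => nth a [:: a; b; c; d; e; f] i].
Let U (X : {set 'I_6}) := pt @: X :|: C.

Let pts : (pt a6 = a) * (pt b6 = b) * (pt c6 = c) * (pt d6 = d) * (pt e6 = e) * (pt f6 = f).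
Proof. by rewrite !ffunE !inordK. Qed.

Let closer_notin x y : x \in W -> closes I (W :\ x) y -> y \notin W.
Proof.
move=> xW /closesP[yW yI _]; apply: contra yI => yinW.
have -> : y = x by apply/eqP; move: yW; rewrite !inE yinW andbT negbK.
by rewrite setD1K.
Qed.

Let bW : b \notin W. Proof. exact: closer_notin eW cb. Qed.
Let dW : d \notin W. Proof. exact: closer_notin aW cd. Qed.
Let fW : f \notin W. Proof. exact: closer_notin cW cf. Qed.

Let ae : a != e. Proof. by rewrite eq_sym. Qed.
Let ca : c != a. Proof. by rewrite eq_sym. Qed.
Let ec : e != c. Proof. by rewrite eq_sym. Qed.

Let corner x : x \in W -> x \notin cl I (W :\ x).
Proof. by move=> xW; rewrite inE setD11 /= setD1K // WI. Qed.

Let dE : d \notin cl I (W :\ e). Proof. exact: (notin_cl_side matI WI aW eW ae cd). Qed.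
Let fE : f \notin cl I (W :\ e). Proof. exact: (notin_cl_side matI WI cW eW ce cf). Qed.
Let bA : b \notin cl I (W :\ a). Proof. exact: (notin_cl_side matI WI eW aW ea cb). Qed.
Let fA : f \notin cl I (W :\ a). Proof. exact: (notin_cl_side matI WI cW aW ca cf). Qed.
Let bC : b \notin cl I (W :\ c). Proof. exact: (notin_cl_side matI WI eW cW ec cb). Qed.
Let dC : d \notin cl I (W :\ c). Proof. exact: (notin_cl_side matI WI aW cW ac cd). Qed.

Let uniq_pts : uniq [:: a; b; c; d; e; f].
Proof.
have bd : b != d by apply: contraNneq dE => <-; exact: closes_cl.
have bf : b != f by apply: contraNneq fE => <-; exact: closes_cl.
have df : d != f by apply: contraNneq fA => <-; exact: closes_cl.
have W1 x y : x \in W -> y \notin W -> (x == y) = false.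
  by move=> xW; apply: contraNF => /eqP<-.
rewrite /= !inE !negb_or ac ae ce bd bf df.
by rewrite !(W1 a) ?(W1 c) ?(W1 e) // ![b == _]eq_sym ![d == _]eq_sym !(W1 c) ?(W1 e).
Qed.

Let pt_inj : injective pt.
Proof.
move=> i j; rewrite !ffunE => /eqP; rewrite (@nth_uniq _ a [:: a; b; c; d; e; f] i j (ltn_ord i) (ltn_ord j) uniq_pts).
by move/eqP/val_inj.
Qed.

Let CI : C \in I.
Proof. apply: (indepS matI _ WI); do 2!apply: (subset_trans (subD1set _ _)); exact: subD1set. Qed.

Let notC i : pt i \notin C.
Proof.
move: i; apply: ord6P; rewrite pts /C !inE ?eqxx ?andbF //=.
- by rewrite (negPf bW) !andbF.
- by rewrite (negPf dW) !andbF.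
- by rewrite (negPf fW) !andbF.
Qed.

Let disj X : [disjoint pt @: X & C].
Proof.
rewrite disjoints_subset; apply/subsetP=> _ /imsetP[i _ ->].
by rewrite inE notC.
Qed.

Let card_U X : #|U X| = #|X| + #|C|.
Proof. by rewrite /U cardsU disjoint_setI0 // cards0 subn0 card_imset. Qed.

Let card_W : #|W| = 3 + #|C|.
Proof.
rewrite (cardsD1 a W) aW (cardsD1 c (W :\ a)) !inE ca cW.
by rewrite (cardsD1 e (W :\ a :\ c)) !inE ec ea eW.
Qed.

Let U_sub X Z : C \subset Z -> (a6 \in X -> a \in Z) -> (b6 \in X -> b \in Z) ->
  (c6 \in X -> c \in Z) -> (d6 \in X -> d \in Z) -> (e6 \in X -> e \in Z) ->
  (f6 \in X -> f \in Z) -> U X \subset Z.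
Proof.
move=> CZ ha hb hc hd he hf; rewrite subUset CZ andbT.
apply/subsetP=> _ /imsetP[i iX ->]; move: i iX.
by apply: ord6P; rewrite pts.
Qed.

(** All six points and [C] lie in the closure of [W], whose rank is [3 + #|C|]. *)
Let U_big X : 3 < #|X| -> U X \notin I.
Proof.
move=> X4; apply/negP=> UI.
have clW x y : closes I (W :\ x) y -> y \in cl I W.
  case/closesP=> _ yI _; rewrite inE; apply/orP; right; apply: contra yI.
  exact: (indepS matI (setUS _ (subD1set _ _))).
have := cl_card matI WI UI; rewrite card_U card_W leq_add2r leqNgt X4 => h.
suff /h : U X \subset cl I W by [].
have sW := subsetP (sub_cl I W).
apply: U_sub => [|_|_|_|_|_|_]; [|exact: sW|exact: clW cb|exact: sW|exact: clW cd|exact: sW|exact: clW cf].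
apply: (subset_trans _ (sub_cl I W)).
do 2!apply: (subset_trans (subD1set _ _)); exact: subD1set.
Qed.

Let mem_U i X : i \in X -> pt i \in U X.
Proof. by move=> iX; rewrite in_setU imset_f. Qed.

Let U_line (x y : T) X : y |: (W :\ x) \notin I -> y \in U X ->
  (forall z, z \in [:: a; c; e] -> z != x -> z \in U X) -> U X \notin I.
Proof.
move=> dep yU hU; apply: contra dep => UI; apply: (indepS matI _ UI).
rewrite subUset sub1set yU; apply/subsetP=> z /setD1P[zx zW].
case zC : (z \in C); first by rewrite in_setU zC orbT.
apply: hU => //; move: zC; rewrite !inE zW andbT.
by case: (z == a); case: (z == c); case: (z == e).
Qed.

Let U_indep X Z : Z \in I -> U X \subset Z -> U X \in I.
Proof. by move=> ZI sZ; apply: (indepS matI sZ ZI). Qed.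

Let sideE w : w \notin cl I (W :\ e) -> [/\ w |: (W :\ e) \in I,
  w |: (b |: (W :\ e :\ a)) \in I & w |: (b |: (W :\ e :\ c)) \in I].
Proof.
by case/(line_indep matI WI cb) => h1 h2; split=> //; apply: h2; rewrite !inE ?ac ?ca ?ae ?ce.
Qed.
Let sideA w : w \notin cl I (W :\ a) -> [/\ w |: (W :\ a) \in I,
  w |: (d |: (W :\ a :\ c)) \in I & w |: (d |: (W :\ a :\ e)) \in I].
Proof.
by case/(line_indep matI WI cd) => h1 h2; split=> //; apply: h2; rewrite !inE ?ca ?ea.
Qed.
Let sideC w : w \notin cl I (W :\ c) -> [/\ w |: (W :\ c) \in I,
  w |: (f |: (W :\ c :\ e)) \in I & w |: (f |: (W :\ c :\ a)) \in I].
Proof.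
by case/(line_indep matI WI cf) => h1 h2; split=> //; apply: h2; rewrite !inE ?ac ?ec.
Qed.

Ltac triple_tac h n1 n2 n3 := apply: (U_indep h); apply: U_sub;
  [ let z := fresh "z" in apply/subsetP; intro z; rewrite !inE;
    by case: (z == a); case: (z == c); case: (z == e); case: (z \in W); do ?rewrite orbT
  | first [ by move/(negP n1) | by move/(negP n2) | by move/(negP n3)
    | by move=> _; rewrite !inE ?eqxx ?aW ?cW ?eW ?ac ?ca ?ae ?ea ?ce ?ec /=; do ?rewrite orbT ].. ].

(* Complements of the triples formed by two points of a side and a point off
   that side; besides the sides, only [{b, d, f}] is not such a triple. *)
Let U_triple X :
  let xa := a6 \in X in let xb := b6 \in X in let xc := c6 \in X in
  let xd := d6 \in X in let xe := e6 \in X in let xf := f6 \in X in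
  [|| [&& ~~ xb, ~~ xd & ~~ xf], [&& ~~ xa, ~~ xd & ~~ xf], [&& ~~ xc, ~~ xd & ~~ xf],
      [&& ~~ xb, ~~ xe & ~~ xf], [&& ~~ xa, ~~ xe & ~~ xf], [&& ~~ xc, ~~ xe & ~~ xf],
      [&& ~~ xb, ~~ xd & ~~ xe], [&& ~~ xa, ~~ xd & ~~ xe], [&& ~~ xc, ~~ xd & ~~ xe],
      [&& ~~ xb, ~~ xc & ~~ xf], [&& ~~ xa, ~~ xc & ~~ xf], [&& ~~ xa, ~~ xb & ~~ xd],
      [&& ~~ xa, ~~ xb & ~~ xc], [&& ~~ xa, ~~ xb & ~~ xe], [&& ~~ xa, ~~ xc & ~~ xd] |
      [&& ~~ xb, ~~ xc & ~~ xe]] -> U X \in I.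
Proof.
move=> xa xb xc xd xe xf.
have [e1 e2 e3] := sideE (corner eW); have [d1 d2 d3] := sideE dE; have [f1 f2 f3] := sideE fE.
have [_ a2 _] := sideA (corner aW); have [_ b2 _] := sideA bA; have [g1 g2 g3] := sideA fA.
have [_ _ k3] := sideC bC; have [_ l2 _] := sideC dC.
case/orP=> [/and3P[n1 n2 n3]|]; first by triple_tac e1 n1 n2 n3.
case/orP=> [/and3P[n1 n2 n3]|]; first by triple_tac e2 n1 n2 n3.
case/orP=> [/and3P[n1 n2 n3]|]; first by triple_tac e3 n1 n2 n3.
case/orP=> [/and3P[n1 n2 n3]|]; first by triple_tac d1 n1 n2 n3.
case/orP=> [/and3P[n1 n2 n3]|]; first by triple_tac d2 n1 n2 n3.
case/orP=> [/and3P[n1 n2 n3]|]; first by triple_tac d3 n1 n2 n3.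
case/orP=> [/and3P[n1 n2 n3]|]; first by triple_tac f1 n1 n2 n3.
case/orP=> [/and3P[n1 n2 n3]|]; first by triple_tac f2 n1 n2 n3.
case/orP=> [/and3P[n1 n2 n3]|]; first by triple_tac f3 n1 n2 n3.
case/orP=> [/and3P[n1 n2 n3]|]; first by triple_tac a2 n1 n2 n3.
case/orP=> [/and3P[n1 n2 n3]|]; first by triple_tac b2 n1 n2 n3.
case/orP=> [/and3P[n1 n2 n3]|]; first by triple_tac g1 n1 n2 n3.
case/orP=> [/and3P[n1 n2 n3]|]; first by triple_tac g2 n1 n2 n3.
case/orP=> [/and3P[n1 n2 n3]|]; first by triple_tac g3 n1 n2 n3.
case/orP=> [/and3P[n1 n2 n3]|]; first by triple_tac k3 n1 n2 n3.
by case/and3P=> n1 n2 n3; triple_tac l2 n1 n2 n3.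
Qed.

Let D := ~: (C :|: pt @: setT).

Let U_minor X : minor_indep I C D (pt @: X) = (U X \in I).
Proof.
rewrite minor_indepE //; case: (_ \in I); rewrite ?andbF // andbT.
apply/subsetP=> _ /imsetP[i _ ->].
by rewrite in_setC in_setU negb_or notC in_setC negbK in_setU imset_f ?inE ?orbT.
Qed.

Let minor_of (N : {set {set 'I_6}}) : (forall X, (X \in N) = (U X \in I)) -> has_minor I N.
Proof.
move=> hN; apply/existsP; exists C; apply/existsP; exists D; apply/andP; split.
  by rewrite disjoints_subset /D setCK subsetUl.
apply/existsP; exists pt; apply/and3P; split.
- exact/injectiveP/pt_inj.
- apply/eqP/setP=> x; rewrite in_setC in_setU in_setC in_setU; case xC: (x \in C) => /=.
    by apply: contraTF xC => /imsetP[i _ ->]; exact: notC.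
  by rewrite negbK.
- by apply/forallP=> X; rewrite hN U_minor.
Qed.

Let U_dep X :
  [|| [&& a6 \in X, b6 \in X & c6 \in X], [&& c6 \in X, d6 \in X & e6 \in X] |
      [&& e6 \in X, f6 \in X & a6 \in X]] -> U X \notin I.
Proof.
have mem i x : pt i = x -> i \in X -> x \in U X by move=> <-; exact: mem_U.
have := (mem _ _ pts.1.1.1.1.1, mem _ _ pts.1.1.1.1.2, mem _ _ pts.1.1.1.2,
  mem _ _ pts.1.1.2, mem _ _ pts.1.2, mem _ _ pts.2).
case=> -[] [] [] [] ha hb hc hd he hf.
have corners (P : T -> Prop) : P a -> P c -> P e -> forall z, z \in [:: a; c; e] -> P z.
  by move=> pa pc pe z; rewrite !inE => /or3P[] /eqP->.
case/or3P => /and3P[h1 h2 h3].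
- case/closesP: cb => _ dep _; apply: (U_line dep); first exact: hb.
  by apply: corners; rewrite ?eqxx // => _; [exact: ha | exact: hc].
- case/closesP: cd => _ dep _; apply: (U_line dep); first exact: hd.
  by apply: corners; rewrite ?eqxx // => _; [exact: hc | exact: he].
- case/closesP: cf => _ dep _; apply: (U_line dep); first exact: hf.
  by apply: corners; rewrite ?eqxx // => _; [exact: ha | exact: he].
Qed.

(** Only the triple [b], [d], [f] is undecided: if it is independent in the contraction the minor is
    [W3], otherwise [MK4]. *)
Lemma triangle_minor : has_minor I W3 || has_minor I MK4.
Proof.
pose bdf := [set b6; d6; f6].
have U3 X : X \subset bdf -> U bdf \in I -> U X \in I.
  by move=> sX bI; apply: (indepS matI _ bI); rewrite setSU // imsetS.
have sub3 X : ~~ (a6 \in X) -> ~~ (c6 \in X) -> ~~ (e6 \in X) -> X \subset bdf.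
  move=> na nc ne; apply/subsetP; apply: ord6P; rewrite !inE ?eqxx ?orbT //.
  - by move/(negP na).
  - by move/(negP nc).
  - by move/(negP ne).
have eq3 X : ~~ (a6 \in X) -> ~~ (c6 \in X) -> ~~ (e6 \in X) -> b6 \in X -> d6 \in X -> f6 \in X -> X = bdf.
  move=> na nc ne hb hd hf; apply/eqP; rewrite eqEsubset sub3 //=.
  by rewrite !subUset !sub1set hb hd hf.
apply/orP; case bI: (U bdf \in I); [left|right]; apply: minor_of => X.
all: have /= tri := @U_triple X; have dep := @U_dep X; have big := @U_big X.
all: have s3 := sub3 X; have e3 := eq3 X; have u3 := U3 X.
all: rewrite ?(in_lines6 X).2 (in_lines6 X).1; rewrite card_set6 in big.
- have {}u3 : [&& ~~ (a6 \in X), ~~ (c6 \in X) & ~~ (e6 \in X)] -> U X \in I.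
    by case/and3P=> na nc ne; apply: u3 (s3 na nc ne) bI.
  move: tri dep big u3; clear.
  case: (U X \in I); case: (a6 \in X); case: (b6 \in X); case: (c6 \in X);
  case: (d6 \in X); case: (e6 \in X); case: (f6 \in X) => // h1 h2 h3 h4;
  by [have := h1 isT | have := h2 isT | have := h3 isT | have := h4 isT].
- have {}e3 : [&& ~~ (a6 \in X), ~~ (c6 \in X), ~~ (e6 \in X), b6 \in X, d6 \in X & f6 \in X] ->
      U X \notin I.
    by case/and5P=> na nc ne hb /andP[hd hf]; rewrite (e3 na nc ne hb hd hf) bI.
  move: tri dep big e3; clear.
  case: (U X \in I); case: (a6 \in X); case: (b6 \in X); case: (c6 \in X);
  case: (d6 \in X); case: (e6 \in X); case: (f6 \in X) => // h1 h2 h3 h4;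
  by [have := h1 isT | have := h2 isT | have := h3 isT | have := h4 isT].
Qed.

End Triangle.

Lemma no_minor_triangle_free (T : finType) (I : {set {set T}}) (E : {set T}) :
  is_matroid I -> ~~ has_minor I W3 -> ~~ has_minor I MK4 -> triangle_free I E.
Proof.
move=> mI n1 n2 W WI _; rewrite leqNgt; apply/negP => /card_gt2P[a [c [e [[ha hc he] [ac ce ea]]]]].
have get x : x \in [set a in W | closers I E (W :\ a) != set0] ->
    x \in W /\ exists y, closes I (W :\ x) y.
  rewrite inE => /andP[xW /set0Pn[y]]; rewrite inE => /andP[_ cy].
  by split=> //; exists y.
have [aW [d cd]] := get a ha; have [cW [f cf]] := get c hc; have [eW [b cb]] := get e he.
have := triangle_minor mI WI aW cW eW ac ce ea cb cd cf.
by rewrite (negPf n1) (negPf n2).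
Qed.

(** * Upper bound *)

(** By the binomial theorem [p.+1 ^ #|T|] is the sum of [p ^ (#|T| - #|F|)] over all [F]. After
    multiplication by [p ^ m], every [F] with at most [m] elements contributes at least
    [p ^ #|T|]. *)
Lemma card_small_families (T : finType) m p : 0 < p ->
  #|[set F : {set T} | #|F| <= m]| * p ^ #|T| <= p ^ m * p.+1 ^ #|T|.
Proof.
case: p => // p _.
have -> : p.+2 ^ #|T| = \sum_(F : {set T}) p.+1 ^ (#|T| - #|F|).
  rewrite -[p.+2]addn1 expnDn (partition_big (fun F : {set T} => inord #|F| : 'I_#|T|.+1) xpredT) //=.
  apply: eq_bigr => i _; rewrite exp1n muln1 -card_draws -sum_nat_const.
  apply: congr_big => // [F|F].
    by rewrite inE -val_eqE /= inordK // ltnS max_card.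
  by rewrite inE => /eqP->.
rewrite big_distrr /= -sum_nat_const big_mkcond /=; apply: leq_sum => F _.
case: ifP => // ; rewrite inE -expnD => Fm.
have FT : #|F| <= #|T| := max_card _.
by rewrite leq_pexp2l // -[leqLHS](subnKC FT) leq_add2r.
Qed.

(** This is (1 + 1/p)^j <= p / (p - j) with denominators cleared. *)
Lemma expn_succ_le p j : j <= p -> p.+1 ^ j * (p - j) <= p ^ j * p.
Proof.
elim: j => [|j IH] jp; first by rewrite subn0.
have h := IH (ltnW jp); rewrite !expnS.
move: h; have -> : p - j = (p - j.+1).+1 by lia.
have : p - j.+1 <= p by lia.
move: (p - j.+1) (p.+1 ^ j) (p ^ j) => d x y; nia.
Qed.

(** With p = 2q the previous bound gives (1 + 1/p)^q <= 2; [(U %/ q).+1] blocks of length [q] cover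
    [U]. *)
Lemma expn_succ_le2 q U : 0 < q -> (2 * q).+1 ^ U <= 2 ^ (U %/ q).+1 * (2 * q) ^ U.
Proof.
move=> q0; set p := 2 * q; set v := (U %/ q).+1.
have hq : p.+1 ^ q <= 2 * p ^ q.
  have := @expn_succ_le p q; have -> : p - q = q by lia.
  by move=> h; rewrite -(leq_pmul2r q0); apply: leq_trans (h _) _; rewrite /p; lia.
have hU : U <= q * v by have := ltn_ceil U q0; lia.
have hv : p.+1 ^ (q * v) <= 2 ^ v * p ^ (q * v) by rewrite !expnM -expnMn leq_exp2r.
have p0 : 0 < p ^ (q * v - U) by rewrite expn_gt0 muln_gt0 q0.
rewrite -(leq_pmul2r p0) -mulnA -expnD subnKC //; apply: leq_trans hv.
rewrite -[in leqRHS](subnKC hU) expnD leq_mul2l; apply/orP; right.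
by case: (posnP (q * v - U)) => [->//|h]; rewrite leq_exp2r.
Qed.

(** Codes are families of at most [m] of the 2^n subsets. Weight [p = 2 ^ e.+1] costs [e.+1] bits
    per member, plus the error term of [expn_succ_le2]; [e] stays free for a later choice. *)
Lemma mX_le n e :
  mX n <= 2 ^ (e.+1 * (576 * 2 ^ n %/ (n.+1 * n.+2) + n.+1 ^ 2) + (2 ^ n %/ 2 ^ e).+1).
Proof.
set m := 576 * 2 ^ n %/ _ + _.
have le1 : mX n <= #|[set F : {set {set 'I_n}} | #|F| <= m]|.
  rewrite /mX -(card_in_imset (f := @code 'I_n)); last first.
    by move=> I1 I2; rewrite !inE => /and3P[m1 _ _] /and3P[m2 _ _]; exact: code_inj.
  apply: subset_leq_card; apply/subsetP=> _ /imsetP[I hI ->].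
  have [mI n1 n2] : [/\ is_matroid I, ~~ has_minor I W3 & ~~ has_minor I MK4].
    by apply/and3P; rewrite inE in hI.
  rewrite inE /m addnC -leq_subLR leq_divRL // mulnBl leq_subLR addnC.
  have := card_code mI (no_minor_triangle_free (E := simple_part I) mI n1 n2).
  by rewrite card_ord.
apply: leq_trans le1 _.
have p0 : 0 < 2 ^ e.+1 by rewrite expn_gt0.
have := @card_small_families {set 'I_n} m _ p0.
have q0 : 0 < 2 ^ e by rewrite expn_gt0.
have cU : #|{set 'I_n}| = 2 ^ n by rewrite -cardsT -powersetT card_powerset cardsT card_ord.
have := expn_succ_le2 #|{set 'I_n}| q0; rewrite -expnS cU.
set U := 2 ^ n; set p := 2 ^ e.+1 in p0 *; set v := (U %/ 2 ^ e).+1 => h1 h2.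
have pU : 0 < p ^ U by rewrite expn_gt0 p0.
rewrite -(leq_pmul2r pU) expnD expnM -/p.
by apply: (leq_trans h2); rewrite -mulnA leq_mul2l h1 orbT.
Qed.

(** * Sparse paving matroids *)

Section SparsePaving.
Variables (T : finType) (r : nat) (F : {set {set T}}).
Hypotheses (r0 : 0 < r) (rT : r < #|T|).
Hypothesis cardF : forall X : {set T}, X \in F -> #|X| = r.
Hypothesis sepF : forall (S : {set T}) x y, x \notin S -> y \notin S ->
  x |: S \in F -> y |: S \in F -> x = y.
Implicit Types (A B X Y S : {set T}).

Definition pavingI : {set {set T}} := [set X : {set T} | (#|X| < r) || ((#|X| == r) && (X \notin F))].

Lemma pavingI_card X : X \in pavingI -> #|X| <= r.
Proof. by rewrite inE => /orP[/ltnW//|/andP[/eqP-> _]]. Qed.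

(** Recovering [F] makes distinct families give distinct matroids. *)
Lemma pavingI_nonbases : [set X : {set T} | (#|X| == r) && (X \notin pavingI)] = F.
Proof.
apply/setP=> X; rewrite !inE; case: eqVneq => [->|nr].
  by rewrite ltnn /= negbK.
by apply/esym/negbTE; apply: contra nr => /cardF ->.
Qed.

(** Augmentation is delicate only for [#|A| = r.-1], where an extension may land in [F]. By [sepF]
    at most one does, and if [B] offered no other element it would equal that member of [F]. *)
Lemma pavingI_matroid : is_matroid pavingI.
Proof.
apply/and3P; split; first by rewrite inE cards0 r0.
  apply/forallP=> A; apply/forallP=> B; apply/implyP=> /andP[BI sAB].
  have [eAB|ltAB] := eqVproper sAB; first by rewrite eAB.
  by rewrite inE (leq_trans (proper_card ltAB) (pavingI_card BI)).
apply/forallP=> A; apply/forallP=> B; apply/implyP=> /andP[/andP[AI BI] ltAB].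
have Br := pavingI_card BI.
have [x xB xA] : exists2 x, x \in B & x \notin A.
  by apply/subsetPn; apply: contraTN ltAB => /subset_leq_card; rewrite leqNgt.
case: (ltnP #|A|.+1 r) => Ar.
  by apply/existsP; exists x; rewrite !inE xA xB cardsU1 xA add1n Ar.
have eA : #|A|.+1 = r by apply/eqP; rewrite eqn_leq Ar (leq_trans ltAB).
have eB : #|B| = r by apply/eqP; rewrite eqn_leq Br -eA.
have inI z : z \notin A -> z |: A \notin F -> z |: A \in pavingI.
  by move=> zA zF; rewrite inE cardsU1 zA add1n eA eqxx zF orbT.
apply/existsP; case xF: (x |: A \in F); last first.
  by exists x; rewrite in_setD xA xB inI ?xF.
have [y yB yxA] : exists2 y, y \in B & y \notin x |: A.
  apply/subsetPn; apply/negP=> sB.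
  have eBA : B = x |: A.
    by apply/eqP; rewrite eqEcard sB cardsU1 xA add1n eA eB leqnn.
  by move: BI; rewrite inE eBA xF andbF orbF -eBA eB ltnn.
move: yxA; rewrite in_setU1 negb_or => /andP[yx yA].
exists y; rewrite in_setD yA yB inI //; apply: contra yx => yF.
by rewrite (sepF yA xA yF xF).
Qed.

Lemma pavingI_mrank_le X : mrank pavingI X <= r.
Proof. by apply/bigmax_leqP => A /andP[AI _]; exact: pavingI_card. Qed.

Lemma pavingI_mrank X A : A \in pavingI -> A \subset X -> #|A| = r -> mrank pavingI X = r.
Proof.
move=> AI sA cA; apply/eqP; rewrite eqn_leq pavingI_mrank_le /= -cA.
apply: (@leq_bigmax_cond _ (fun A : {set T} => (A \in pavingI) && (A \subset X)) (fun A : {set T} => #|A|) A).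
by rewrite /= AI sA.
Qed.

(** Of two one-element extensions of a set of size [r.-1], at most one lies in [F]; [rT] provides
    both. *)
Lemma pavingI_mrankT : mrank pavingI setT = r.
Proof.
have : 0 < #|[set A : {set T} | #|A| == r.-1]| by rewrite card_draws bin_gt0; lia.
case/card_gt0P=> S; rewrite inE => /eqP cS.
have : 1 < #|~: S| by have := cardsC S; lia.
case/card_gt1P=> x [y [xS yS xy]]; rewrite !inE in xS yS.
have bas z : z \notin S -> z |: S \notin F -> mrank pavingI setT = r.
  move=> zS zF; have cz : #|z |: S| = r by rewrite cardsU1 zS cS; lia.
  by apply: (@pavingI_mrank _ (z |: S)); rewrite ?subsetT // inE cz eqxx zF orbT.
case xF: (x |: S \in F); last by apply: (bas x xS); rewrite xF.
by apply: (bas y yS); apply: contra xy => yF; rewrite (sepF xS yS xF yF).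
Qed.

(** A nonspanning circuit has exactly [r] elements and so lies in [F]. Exchanging one of its
    elements for an outside [y] leaves [F] by [sepF], so adding [y] makes it spanning. *)
Lemma pavingI_sparse : sparse_paving pavingI.
Proof.
apply/forallP=> X; apply/implyP=> /andP[/andP[XI /forallP circX] nsX].
rewrite /hyperplane nsX /=.
have circ x : x \in X -> X :\ x \in pavingI by move=> xX; have := circX x; rewrite xX.
have X0 : 0 < #|X|.
  by rewrite lt0n cards_eq0; apply: contraNneq XI => ->; rewrite inE cards0 r0.
have [x xX] : exists x, x \in X by apply/card_gt0P.
have cX : #|X| <= r.
  rewrite leqNgt; apply/negP=> ltX; move: nsX; rewrite /spanning pavingI_mrankT.
  rewrite (@pavingI_mrank X (X :\ x)) ?eqxx ?subD1set ?circ //.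
  apply/eqP; rewrite eqn_leq (pavingI_card (circ x xX)).
  by move: ltX; rewrite (cardsD1 x) xX.
have XF : X \in F.
  by move: XI; rewrite inE negb_or negb_and negbK -leqNgt => /andP[rX]; rewrite eqn_leq cX rX.
apply/forallP=> y; apply/implyP; rewrite inE => yX.
rewrite /spanning pavingI_mrankT; apply/eqP; apply: (@pavingI_mrank _ (y |: (X :\ x))).
- rewrite inE (card_swap yX xX) (cardF XF) eqxx ltnn /=; apply/negP=> yF.
  have eyx : y = x.
    by apply: (sepF (S := X :\ x)); rewrite ?setD1K // !inE ?eqxx // (negPf yX) andbF.
  by rewrite eyx xX in yX.
- by rewrite setUS // subD1set.
- by rewrite (card_swap yX xX) cardF.
Qed.

End SparsePaving.

(* Graham-Sloane: the sets of size [n./2] with a prescribed sum modulo [n]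
   pairwise differ in more than one exchange. *)
Lemma sp_ge n : 1 < n -> exists2 L, 'C(n, n./2) <= n * L & 2 ^ L <= sp n.
Proof.
move=> n1; set r := n./2.
have r0 : 0 < r by rewrite /r half_gt0.
have rn : r < n by rewrite /r; lia.
pose s (X : {set 'I_n}) := (\sum_(i in X) i) %% n.
pose V k := [set X : {set 'I_n} | (#|X| == r) && (s X == k)].
(* Pigeonhole over the [n] residues of the sum. *)
have [k hk] : exists k : 'I_n, 'C(n, r) <= n * #|V k|.
  apply/existsP; apply: contraT => /existsPn h.
  have n0 : 0 < n := ltnW n1.
  have : \sum_(k < n) n * #|V k| < \sum_(k < n) 'C(n, r).
    rewrite (bigD1 (Ordinal n0)) //= [ltnRHS](bigD1 (Ordinal n0)) //= -addSn leq_add //.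
      by rewrite ltnNge; exact: (h (Ordinal n0)).
    by apply: leq_sum => i _; apply: ltnW; rewrite ltnNge; exact: (h i).
  rewrite -big_distrr /= sum_nat_const card_ord ltn_pmul2l // -[n in 'C(n, _)]card_ord -card_draws.
  rewrite -[X in _ < X]sum1_card (partition_big (fun X : {set 'I_n} => Ordinal (ltn_pmod (\sum_(i in X) i) n0)) xpredT) //=.
  rewrite ltnNge; case/negP; apply: leq_sum => i _; rewrite -sum1_card.
  by rewrite leq_eqVlt; apply/orP; left; apply/eqP; apply: eq_bigl => X; rewrite !inE -val_eqE.
exists #|V k| => //.
have VF (F : {set {set 'I_n}}) : F \subset V k -> (forall X : {set 'I_n}, X \in F -> #|X| = r) /\
    (forall (S : {set 'I_n}) x y, x \notin S -> y \notin S -> x |: S \in F -> y |: S \in F -> x = y).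
  move=> /subsetP sF; split=> [X XF|S x y xS yS xF yF].
    by have := sF X XF; rewrite inE => /andP[/eqP].
  move: (sF _ xF) (sF _ yF); rewrite !inE => /andP[_ /eqP sx] /andP[_ /eqP sy].
  have : s (x |: S) = s (y |: S) by rewrite sx sy.
  rewrite /s !big_setU1 //= => /eqP; rewrite eqn_modDr !modn_small // => /eqP; exact: val_inj.
rewrite -card_powerset /sp -(card_in_imset (f := @pavingI 'I_n r) (D := mem (powerset (V k)))); last first.
  move=> F1 F2; rewrite !powersetE => /VF[c1 _] /VF[c2 _] e.
  by rewrite -(pavingI_nonbases c1) -(pavingI_nonbases c2) e.
apply: subset_leq_card; apply/subsetP=> _ /imsetP[F hF ->].
have [cF sF] : _ /\ _ := VF F (etrans (esym (powersetE _ _)) hF).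
have rT : r < #|'I_n| by rewrite card_ord.
rewrite inE; apply/andP; split; first exact: pavingI_matroid.
exact: pavingI_sparse.
Qed.

(** * Comparison *)

Lemma central_bin_succ m :
  m.+1 * 'C(m.*2.+1, m) = m.*2.+1 * 'C(m.*2, m) /\ 'C(m.*2.+2, m.+1) = 2 * 'C(m.*2.+1, m).
Proof.
have h1 := mul_bin_down m.*2.+1 m; have h2 := mul_bin_diag m.*2.+2 m.
rewrite /= in h1 h2; split.
  by rewrite h1; congr (_ * _); rewrite -addnn; lia.
apply/eqP; rewrite -(eqn_pmul2l (ltn0Sn m)) -h2; apply/eqP; rewrite -mul2n; lia.
Qed.

(** Squaring avoids square roots. The induction rests on the identity (2m+1)^2 (4m+5) = 4 (m+1)^2
    (4m+1) + 1. *)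
Lemma central_bin_even m : 16 ^ m <= 'C(m.*2, m) ^ 2 * (4 * m + 1).
Proof.
elim: m => [|m IH] //; have [h1 h2] := central_bin_succ m.
rewrite doubleS h2 expnS; move: h1 IH; rewrite -mul2n.
move: 'C((2 * m).+1, m) 'C(2 * m, m) (16 ^ m) => x y z h1 h.
have m0 : 0 < m.+1 * m.+1 by [].
rewrite -(leq_pmul2r m0).
have e : (2 * x) ^ 2 * (4 * m.+1 + 1) * (m.+1 * m.+1) =
   4 * ((2 * m).+1 * (2 * m).+1) * (4 * m + 5) * (y * y).
  have -> : (2 * x) ^ 2 * (4 * m.+1 + 1) * (m.+1 * m.+1) = 4 * (4 * m + 5) * ((m.+1 * x) * (m.+1 * x)).
    by rewrite -mulnn; lia.
  by rewrite h1; lia.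
rewrite e; have h' : z <= y * y * (4 * m + 1) by rewrite mulnn.
apply: (@leq_trans (16 * (y * y * (4 * m + 1)) * (m.+1 * m.+1))).
  by rewrite leq_mul2r leq_mul2l h' orbT.
by move: (y * y) => u; nia.
Qed.

(** For odd [n], the next central coefficient is exactly twice this one. *)
Lemma central_bin_ge n : 4 ^ n <= 'C(n, n./2) ^ 2 * (2 * n + 3).
Proof.
have := odd_double_half n; move: n./2 (odd n) => m [] <-.
  have [h1 h2] := central_bin_succ m; have := central_bin_even m.+1.
  rewrite doubleS h2 add1n expnMn.
  have -> : 16 ^ m.+1 = 4 * 4 ^ m.*2.+1.
    by rewrite -expnS -(expnM 4 2) -doubleS -mul2n.
  by rewrite -mulnA leq_mul2l /= -mul2n; move/leq_trans; apply; rewrite leq_mul2l; apply/orP; right; lia.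
rewrite add0n; apply: leq_trans (_ : 16 ^ m <= _).
  by rewrite -(expnM 4 2) -mul2n.
apply: (leq_trans (central_bin_even m)); rewrite leq_mul2l; apply/orP; right; rewrite -mul2n; lia.
Qed.

Lemma mX_sp_le t n : 4 ^ 20 <= n -> t < n -> mX n * 2 ^ t <= sp n.
Proof.
move=> n20 tn.
have n1 : 1 < n.
  have : 4 ^ 0 < 4 ^ 20 by rewrite ltn_exp2l.
  by rewrite expn0 => h; exact: (leq_trans h n20).
have n0 : 0 < n by exact: ltnW.
(* With base 4, 2^w has the order of sqrt n, the loss in the central binomial coefficient. *)
have [w [w20 wn nw]] : exists w, [/\ 20 <= w, 4 ^ w <= n & n < 4 ^ w.+1].
  exists (trunc_log 4 n); split; first exact: trunc_log_max.
    exact: trunc_logP.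
  exact: trunc_log_ltn.
(* This is the decisive comparison of log n with sqrt n. In 577, the 576 comes from [mX_le] and 1
   absorbs the small sets; the added 2 covers the error term and [t]. *)
have hw : (577 * (4 * w + 5) + 2) * 2 ^ w.+2 <= 4 ^ w.
  have -> : 4 ^ w = 2 ^ (w - 2) * 2 ^ w.+2 by rewrite -expnD -(expnM 2 2); congr (_ ^ _); lia.
  rewrite leq_mul2r; apply/orP; right.
  have [j ->] : exists j, w = j + 20 by exists (w - 20); lia.
  have -> : j + 20 - 2 = j + 18 by lia.
  elim: j {w20 wn nw} => [|j IH]; first by vm_compute.
  have -> : j.+1 + 18 = (j + 18).+1 by lia.
  rewrite expnS; lia.
have w8 : 8 * w + 8 <= n.
  apply: leq_trans wn; apply: leq_trans hw; have : 0 < 2 ^ w.+2 by rewrite expn_gt0.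
  nia.
have hn4 : n ^ 2 * n.+1 ^ 2 <= 2 ^ n.
  apply: (@leq_trans (2 ^ (8 * w + 8))); last by rewrite leq_exp2l.
  have -> : 2 ^ (8 * w + 8) = (4 ^ w.+1) ^ 2 * (4 ^ w.+1) ^ 2.
    by rewrite -!expnM -expnD -(expnM 2 2); congr (_ ^ _); lia.
  by apply: leq_mul; rewrite leq_exp2r // ltnW.
have hC : 2 ^ n <= 'C(n, n./2) * 2 ^ w.+2.
  rewrite -(@leq_exp2r _ _ 2) // expnMn -!expnM mulnC expnM.
  apply: (leq_trans (central_bin_ge n)); rewrite leq_mul2l; apply/orP; right.
  have -> : 2 ^ (w.+2 * 2) = 4 * 4 ^ w.+1 by rewrite -expnS -(expnM 2 2) mulnC.
  by lia.
have [L hL] := sp_ge n1; apply: leq_trans.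
(* The choice [e = 4 * w + 4] makes [2 ^ e] exceed [n ^ 2], so the error term is at most 2^n /
   n^2. *)
apply: (leq_trans (leq_mul (mX_le n (4 * w + 4)) (leqnn (2 ^ t)))).
rewrite -expnD leq_exp2l //.
set x := 576 * _ %/ _; set y := 2 ^ n %/ _; set C := 'C(n, n./2) in hC hL.
have n2 : 0 < n ^ 2 by rewrite expn_gt0 n0.
have hx : n ^ 2 * x <= 576 * 2 ^ n.
  apply: (@leq_trans (x * (n.+1 * n.+2))); last exact: leq_trunc_div.
  rewrite mulnC leq_mul2l -mulnn; apply/orP; right; nia.
have hy : n ^ 2 * y <= 2 ^ n.
  apply: (@leq_trans (y * 2 ^ (4 * w + 4))); last exact: leq_trunc_div.
  rewrite mulnC leq_mul2l; apply/orP; right.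
  have -> : 2 ^ (4 * w + 4) = (4 ^ w.+1) ^ 2 by rewrite -!expnM -(expnM 2 2); congr (_ ^ _); lia.
  by rewrite leq_exp2r // ltnW.
have hnC : (577 * (4 * w + 5) + 2) * 2 ^ n <= n * C.
  apply: (@leq_trans ((577 * (4 * w + 5) + 2) * (C * 2 ^ w.+2))).
    by rewrite leq_mul2l hC orbT.
  by rewrite mulnCA mulnC leq_mul2r (leq_trans hw wn) orbT.
rewrite -(leq_pmul2l n2); apply: (@leq_trans (n * C)); last first.
  by rewrite -mulnn -mulnA leq_mul2l hL orbT.
apply: leq_trans hnC.
have ht : n ^ 2 * t.+1 <= 2 ^ n.
  by apply: leq_trans hn4; rewrite leq_mul2l -mulnn; apply/orP; right; nia.
have -> : n ^ 2 * ((4 * w + 4).+1 * (x + n.+1 ^ 2) + y.+1 + t) =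
  (4 * w + 5) * (n ^ 2 * x + n ^ 2 * n.+1 ^ 2) + n ^ 2 * y + n ^ 2 * t.+1 by lia.
have h1 : (4 * w + 5) * (n ^ 2 * x + n ^ 2 * n.+1 ^ 2) <= (4 * w + 5) * (577 * 2 ^ n).
  by rewrite leq_mul2l; apply/orP; right; lia.
by lia.
Qed.

Local Open Scope ring_scope.

(* mX(n) = o(sp(n)) as n -> oo *)
Theorem theorem13 :
  forall eps : rat, 0 < eps ->
  exists N : nat, forall n : nat, (N <= n)%N ->
    (mX n)%:R <= eps * (sp n)%:R.
Proof.
move=> eps eps0.
(* [mX_sp_le] beats any fixed factor [2 ^ t], so one exceeding 1/eps is enough. *)
have [t ht] : exists t : nat, 1 <= eps * (2 ^ t)%:R.
  have [t ht] : exists t : nat, eps^-1 < t%:R.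
    by exists (Num.bound eps^-1); apply: le_lt_trans (archi_boundP _); rewrite ?ler_norm // invr_ge0 ltW.
  exists t; rewrite -ler_pdivrMl // mulr1; apply: (le_trans (ltW ht)).
  by rewrite ler_nat ltnW // ltn_expl.
exists (maxn (4 ^ 20) t.+1) => n; rewrite geq_max => /andP[n20 tn].
have := mX_sp_le n20 tn; rewrite -(ler_nat rat) natrM => h.
apply: (@le_trans _ _ (eps * ((mX n)%:R * (2 ^ t)%:R))); last by rewrite ler_pM2l.
by rewrite mulrCA ler_peMr ?ler0n.
Qed.
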